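(* Consider the linear system, the forward KF-without-DF and the inverse filter I-KF-without-DF described in the context. Suppose that the forward KF-without-DF is asymptotically stable and is such that its gain matrices $\mathbf{M}_k$ and $\mathbf{K}_k$ converge, as $k\to\infty$, to limiting gain matrices $\overline{\mathbf{M}}$ and $\overline{\mathbf{K}}$, respectively. Suppose that the defender's measurement noise covariance matrix $\bm{\Sigma}_{\epsilon}$ is positive definite. Denote $$\overline{\mathbf{F}}=(\mathbf{I}-\overline{\mathbf{K}}\mathbf{H})(\mathbf{I}-\mathbf{B}\overline{\mathbf{M}}\mathbf{H})\mathbf{F},\qquad \overline{\mathbf{E}}=\mathbf{B}\overline{\mathbf{M}}-\overline{\mathbf{K}}\mathbf{H}\mathbf{B}\overline{\mathbf{M}}+\overline{\mathbf{K}},\qquad \overline{\mathbf{Q}}=\overline{\mathbf{E}}\mathbf{R}\overline{\mathbf{E}}^{T}.$$ Assume that the pair $(\overline{\mathbf{F}},\mathbf{G})$ is observable and that the pair $(\overline{\mathbf{F}},\mathbf{C})$ is controllable, where $\mathbf{C}$ is a matrix such that $\overline{\mathbf{Q}}=\mathbf{C}\mathbf{C}^{T}$. Then the I-KF-without-DF is asymptotically stable.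
   Context: Notation: $\mathcal{N}(\bm{\mu},\mathbf{Q})$ is the Gaussian distribution with mean $\bm\mu$ and covariance $\mathbf{Q}$; $\mathbf{I}$ is an identity matrix. System: $\mathbf{x}_{k+1}=\mathbf{F}\mathbf{x}_k+\mathbf{B}\mathbf{u}_k+\mathbf{w}_k$ with $\mathbf{x}_k\in\mathbb{R}^n$, $\mathbf{u}_k\in\mathbb{R}^m$, $\mathbf{w}_k\sim\mathcal{N}(\mathbf{0},\mathbf{Q})$ (state of the ''defender''; $\mathbf{u}_k$ is an input unknown to the ''adversary''). The adversary observes $\mathbf{y}_k=\mathbf{H}\mathbf{x}_k+\mathbf{v}_k\in\mathbb{R}^p$, $\mathbf{v}_k\sim\mathcal{N}(\mathbf{0},\mathbf{R})$. The adversary computes an estimate $\hat{\mathbf{x}}_k$ of $\mathbf{x}_k$ by the forward filter below, and the defender observes $\mathbf{a}_k=\mathbf{G}\hat{\mathbf{x}}_k+\bm{\epsilon}_k\in\mathbb{R}^{n_a}$, $\bm{\epsilon}_k\sim\mathcal{N}(\mathbf{0},\bm{\Sigma}_\epsilon)$. The noise processes $\{\mathbf{w}_k\},\{\mathbf{v}_k\},\{\bm\epsilon_k\}$ are mutually independent and i.i.d. in time. The defender knows $\mathbf{x}_k$ exactly, the system model and the forward filter. It is assumed that $\mathrm{rank}(\mathbf{H}\mathbf{B})=\mathrm{rank}(\mathbf{B})=m$ (existence of the forward filter; it implies $n\ge m$, $p\ge m$). Forward filter (KF-without-DF), started from an initial estimate $\hat{\mathbf{x}}_0$ and covariance $\bm\Sigma_0$: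 $\hat{\mathbf{x}}_{k+1|k}=\mathbf{F}\hat{\mathbf{x}}_k$, $\bm\Sigma_{k+1|k}=\mathbf{F}\bm\Sigma_k\mathbf{F}^T+\mathbf{Q}$, $\mathbf{S}_{k+1}=\mathbf{H}\bm\Sigma_{k+1|k}\mathbf{H}^T+\mathbf{R}$, $\mathbf{M}_{k+1}=(\mathbf{B}^T\mathbf{H}^T\mathbf{S}_{k+1}^{-1}\mathbf{H}\mathbf{B})^{-1}\mathbf{B}^T\mathbf{H}^T\mathbf{S}_{k+1}^{-1}$, $\hat{\mathbf{u}}_k=\mathbf{M}_{k+1}(\mathbf{y}_{k+1}-\mathbf{H}\hat{\mathbf{x}}_{k+1|k})$, $\widetilde{\mathbf{x}}_{k+1|k+1}=\hat{\mathbf{x}}_{k+1|k}+\mathbf{B}\hat{\mathbf{u}}_k$, $\widetilde{\bm\Sigma}_{k+1|k+1}=(\mathbf{I}-\mathbf{B}\mathbf{M}_{k+1}\mathbf{H})\bm\Sigma_{k+1|k}(\mathbf{I}-\mathbf{B}\mathbf{M}_{k+1}\mathbf{H})^T+\mathbf{B}\mathbf{M}_{k+1}\mathbf{R}\mathbf{M}_{k+1}^T\mathbf{B}^T$, $\mathbf{K}_{k+1}=\bm\Sigma_{k+1|k}\mathbf{H}^T\mathbf{S}_{k+1}^{-1}$, $\hat{\mathbf{x}}_{k+1}=\widetilde{\mathbf{x}}_{k+1|k+1}+\mathbf{K}_{k+1}(\mathbf{y}_{k+1}-\mathbf{H}\widetilde{\mathbf{x}}_{k+1|k+1})$, $\bm\Sigma_{k+1}=\widetilde{\bm\Sigma}_{k+1|k+1}-\mathbf{K}_{k+1}(\widetilde{\bm\Sigma}_{k+1|k+1}\mathbf{H}^T-\mathbf{B}\mathbf{M}_{k+1}\mathbf{R})^T$.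 With $\widetilde{\mathbf{F}}_k=(\mathbf{I}-\mathbf{K}_{k+1}\mathbf{H})(\mathbf{I}-\mathbf{B}\mathbf{M}_{k+1}\mathbf{H})\mathbf{F}$ and $\mathbf{E}_k=\mathbf{B}\mathbf{M}_{k+1}-\mathbf{K}_{k+1}\mathbf{H}\mathbf{B}\mathbf{M}_{k+1}+\mathbf{K}_{k+1}$, the forward estimate evolves as $\hat{\mathbf{x}}_{k+1}=\widetilde{\mathbf{F}}_k\hat{\mathbf{x}}_k+\mathbf{E}_k\mathbf{H}\mathbf{x}_{k+1}+\mathbf{E}_k\mathbf{v}_{k+1}$. Inverse filter (I-KF-without-DF), which computes an estimate $\hat{\hat{\mathbf{x}}}_k$ of $\hat{\mathbf{x}}_k$ from $\mathbf{a}_k$ and the known $\mathbf{x}_k$: $\hat{\hat{\mathbf{x}}}_{k+1|k}=\widetilde{\mathbf{F}}_k\hat{\hat{\mathbf{x}}}_k+\mathbf{E}_k\mathbf{H}\mathbf{x}_{k+1}$, $\overline{\bm\Sigma}_{k+1|k}=\widetilde{\mathbf{F}}_k\overline{\bm\Sigma}_k\widetilde{\mathbf{F}}_k^T+\overline{\mathbf{Q}}_k$ with $\overline{\mathbf{Q}}_k=\mathbf{E}_k\mathbf{R}\mathbf{E}_k^T$, $\overline{\mathbf{S}}_{k+1}=\mathbf{G}\overline{\bm\Sigma}_{k+1|k}\mathbf{G}^T+\bm\Sigma_\epsilon$, $\hat{\hat{\mathbf{x}}}_{k+1}=\hat{\hat{\mathbf{x}}}_{k+1|k}+\overline{\bm\Sigma}_{k+1|k}\mathbf{G}^T\overline{\mathbf{S}}_{k+1}^{-1}(\mathbf{a}_{k+1}-\mathbf{G}\hat{\hat{\mathbf{x}}}_{k+1|k})$,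 $\overline{\bm\Sigma}_{k+1}=\overline{\bm\Sigma}_{k+1|k}-\overline{\bm\Sigma}_{k+1|k}\mathbf{G}^T\overline{\mathbf{S}}_{k+1}^{-1}\mathbf{G}\overline{\bm\Sigma}_{k+1|k}$. Asymptotic stability of a filter means that the (linear) dynamics of its error is asymptotically stable, i.e. the noise-free part of the error recursion drives every initial error to zero. For the forward filter the error is $\mathbf{x}_k-\hat{\mathbf{x}}_k$, with noise-free recursion matrix $\widetilde{\mathbf{F}}_k$; for the inverse filter the error is the one-step prediction error $\overline{\mathbf{e}}_{k+1|k}=\hat{\mathbf{x}}_{k+1}-\hat{\hat{\mathbf{x}}}_{k+1|k}$, with noise-free recursion matrix $\widetilde{\mathbf{F}}_k(\mathbf{I}-\overline{\bm\Sigma}_{k|k-1}\mathbf{G}^T\overline{\mathbf{S}}_k^{-1}\mathbf{G})$. *)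

(* Defs.v *)
From HB Require Import structures.
From mathcomp Require Import all_boot all_order all_algebra.
From mathcomp Require Import all_classical all_reals all_analysis.
From mathcomp Require Import ring.

Set Implicit Arguments.
Unset Strict Implicit.
Unset Printing Implicit Defensive.

Import Order.TTheory GRing.Theory Num.Theory.
Import numFieldNormedType.Exports.

Local Open Scope classical_set_scope.
Local Open Scope ring_scope.

(* A covariance matrix is a symmetric positive semidefinite matrix: Gaussian
   distributions are allowed to be degenerate. *)
Definition psd (R : realType) (n : nat) (A : 'M[R]_n) : Prop :=
  A^T = A /\ forall x : 'cV[R]_n, 0 <= (x^T *m A *m x) 0 0.

Definition posdef (R : realType) (n : nat) (A : 'M[R]_n) : Prop :=
  A^T = A /\ forall x : 'cV[R]_n, x != 0 -> 0 < (x^T *m A *m x) 0 0.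

(* [\mxcol_(i < n) (G *m F ^+ i)] is the observability matrix
   [G; G F; ...; G F^(n-1)]. *)
Definition observable (R : realType) (n q : nat)
    (F : 'M[R]_n) (G : 'M[R]_(q, n)) : Prop :=
  \rank (\mxcol_(i < n) (G *m F ^+ i)) = n.

(* [\mxrow_(i < n) (F ^+ i *m C)] is the controllability matrix
   [C, F C, ..., F^(n-1) C]. *)
Definition controllable (R : realType) (n q : nat)
    (F : 'M[R]_n) (C : 'M[R]_(n, q)) : Prop :=
  \rank (\mxrow_(i < n) (F ^+ i *m C)) = n.

(* Asymptotic stability of e_(k+1) = A_k e_k.  By linearity in finite
   dimension, convergence to zero of all the solutions implies that they are
   bounded uniformly in the initial value, i.e. Lyapunov stability. *)
Definition asymptotically_stable (R : realType) (n : nat)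
    (A : nat -> 'M[R]_n) : Prop :=
  forall e : nat -> 'cV[R]_n,
    (forall k, e k.+1 = A k *m e k) -> e @ \oo --> (0 : 'cV[R]_n).

(* The matrices (I - K H)(I - B M H) F and B M - K H B M + K, as functions of
   the gains, so that they serve both at time k and in the limit. *)
Definition closed_loop (R : realType) (n m p : nat) (F : 'M[R]_n)
    (B : 'M[R]_(n, m)) (H : 'M[R]_(p, n))
    (M : 'M[R]_(m, p)) (K : 'M[R]_(n, p)) : 'M[R]_n :=
  (1%:M - K *m H) *m (1%:M - B *m M *m H) *m F.

Definition input_matrix (R : realType) (n m p : nat)
    (B : 'M[R]_(n, m)) (H : 'M[R]_(p, n))
    (M : 'M[R]_(m, p)) (K : 'M[R]_(n, p)) : 'M[R]_(n, p) :=
  B *m M - K *m H *m B *m M + K.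

(* Time indices: [fwd_cov k] is Sigma_k, whereas [fwd_pred_cov k],
   [fwd_innov_cov k], [fwd_M k], [fwd_K k], [fwd_tilde_cov k] are
   Sigma_(k+1|k), S_(k+1), M_(k+1), K_(k+1), tilde Sigma_(k+1|k+1);
   [fwd_F k] and [fwd_E k] are tilde F_k and E_k.  [V] is the covariance of
   the adversary's measurement noise v_k. *)
Section ForwardFilter.
Variables (R : realType) (n m p : nat).
Variables (F : 'M[R]_n) (B : 'M[R]_(n, m)) (H : 'M[R]_(p, n)).
Variables (Q : 'M[R]_n) (V : 'M[R]_p) (Sigma0 : 'M[R]_n).

Definition step_pred_cov (Sigma : 'M[R]_n) : 'M[R]_n :=
  F *m Sigma *m F^T + Q.

Definition step_innov_cov (Sigma : 'M[R]_n) : 'M[R]_p :=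
  H *m step_pred_cov Sigma *m H^T + V.

Definition step_M (Sigma : 'M[R]_n) : 'M[R]_(m, p) :=
  let Sinv := invmx (step_innov_cov Sigma) in
  invmx (B^T *m H^T *m Sinv *m H *m B) *m B^T *m H^T *m Sinv.

Definition step_K (Sigma : 'M[R]_n) : 'M[R]_(n, p) :=
  step_pred_cov Sigma *m H^T *m invmx (step_innov_cov Sigma).

Definition step_tilde_cov (Sigma : 'M[R]_n) : 'M[R]_n :=
  let M := step_M Sigma in
  let D := 1%:M - B *m M *m H in
  D *m step_pred_cov Sigma *m D^T + B *m M *m V *m M^T *m B^T.

Definition step_cov (Sigma : 'M[R]_n) : 'M[R]_n :=
  let M := step_M Sigma in
  let T := step_tilde_cov Sigma in
  T - step_K Sigma *m (T *m H^T - B *m M *m V)^T.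

Fixpoint fwd_cov (k : nat) : 'M[R]_n :=
  if k is j.+1 then step_cov (fwd_cov j) else Sigma0.

Definition fwd_innov_cov (k : nat) : 'M[R]_p := step_innov_cov (fwd_cov k).
Definition fwd_M (k : nat) : 'M[R]_(m, p) := step_M (fwd_cov k).
Definition fwd_K (k : nat) : 'M[R]_(n, p) := step_K (fwd_cov k).
Definition fwd_F (k : nat) : 'M[R]_n := closed_loop F B H (fwd_M k) (fwd_K k).
Definition fwd_E (k : nat) : 'M[R]_(n, p) := input_matrix B H (fwd_M k) (fwd_K k).

Fixpoint fwd_est (xhat0 : 'cV[R]_n) (y : nat -> 'cV[R]_p) (k : nat) : 'cV[R]_n :=
  if k is j.+1 then
    let xpred := F *m fwd_est xhat0 y j in
    let uhat := fwd_M j *m (y j.+1 - H *m xpred) in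
    let xtilde := xpred + B *m uhat in
    xtilde + fwd_K j *m (y j.+1 - H *m xtilde)
  else xhat0.

End ForwardFilter.

(* [inv_cov k] is bar Sigma_k, whereas [inv_pred_cov k], [inv_innov_cov k] and
   [inv_gain k] are bar Sigma_(k+1|k), bar S_(k+1) and
   bar Sigma_(k+1|k) G^T bar S_(k+1)^-1.  [Ft] and [E] stand for the sequences
   tilde F_k and E_k of the forward filter, [W] for the covariance
   Sigma_epsilon of the defender's measurement noise. *)
Section InverseFilter.
Variables (R : realType) (n p q : nat).
Variables (Ft : nat -> 'M[R]_n) (E : nat -> 'M[R]_(n, p)) (V : 'M[R]_p).
Variables (G : 'M[R]_(q, n)) (W : 'M[R]_q) (bSigma0 : 'M[R]_n).

Definition step_inv_pred_cov (k : nat) (Sigma : 'M[R]_n) : 'M[R]_n :=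
  Ft k *m Sigma *m (Ft k)^T + E k *m V *m (E k)^T.

Definition step_inv_innov_cov (k : nat) (Sigma : 'M[R]_n) : 'M[R]_q :=
  G *m step_inv_pred_cov k Sigma *m G^T + W.

Definition step_inv_gain (k : nat) (Sigma : 'M[R]_n) : 'M[R]_(n, q) :=
  step_inv_pred_cov k Sigma *m G^T *m invmx (step_inv_innov_cov k Sigma).

Fixpoint inv_cov (k : nat) : 'M[R]_n :=
  if k is j.+1 then
    step_inv_pred_cov j (inv_cov j)
      - step_inv_gain j (inv_cov j) *m G *m step_inv_pred_cov j (inv_cov j)
  else bSigma0.

Definition inv_gain (k : nat) : 'M[R]_(n, q) := step_inv_gain k (inv_cov k).

(* The matrix tilde F_(k+1) (I - bar Sigma_(k+1|k) G^T bar S_(k+1)^-1 G) that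
   takes the one-step prediction error at time k+1, bar e_(k+1|k), to
   bar e_(k+2|k+1); the first prediction error is bar e_(1|0). *)
Definition inv_error_matrix (k : nat) : 'M[R]_n :=
  Ft k.+1 *m (1%:M - inv_gain k *m G).

Variables (H : 'M[R]_(p, n)) (x : nat -> 'cV[R]_n) (a : nat -> 'cV[R]_q).

Fixpoint inv_est (xhh0 : 'cV[R]_n) (k : nat) : 'cV[R]_n :=
  if k is j.+1 then
    let xpred := Ft j *m inv_est xhh0 j + E j *m H *m x j.+1 in
    xpred + inv_gain j *m (a j.+1 - G *m xpred)
  else xhh0.

Definition inv_pred_est (xhh0 : 'cV[R]_n) (k : nat) : 'cV[R]_n :=
  Ft k *m inv_est xhh0 k + E k *m H *m x k.+1.

End InverseFilter.

(* The error recursions of the two filters, for arbitrary realisations of the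
   inputs and of the noises: [fwd_F] and [inv_error_matrix] are the matrices of
   their noise-free parts. *)
Section ErrorDynamics.
Variables (R : realType) (n m p q : nat).
Variables (F : 'M[R]_n) (B : 'M[R]_(n, m)) (H : 'M[R]_(p, n)).
Variables (Q : 'M[R]_n) (V : 'M[R]_p) (Sigma0 : 'M[R]_n).
Variables (G : 'M[R]_(q, n)) (W : 'M[R]_q) (bSigma0 : 'M[R]_n).
Variables (x w : nat -> 'cV[R]_n) (u : nat -> 'cV[R]_m).
Variables (y v : nat -> 'cV[R]_p) (a eps : nat -> 'cV[R]_q).
Variables (xhat0 xhh0 : 'cV[R]_n).

Let M := fwd_M F B H Q V Sigma0.
Let K := fwd_K F B H Q V Sigma0.
Let Ft := fwd_F F B H Q V Sigma0.
Let E := fwd_E F B H Q V Sigma0.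
Let xhat := fwd_est F B H Q V Sigma0 xhat0 y.
Let xhh := inv_est Ft E V G W bSigma0 H x a xhh0.
Let xpred := inv_pred_est Ft E V G W bSigma0 H x a xhh0.

Hypothesis xE : forall k, x k.+1 = F *m x k + B *m u k + w k.
Hypothesis yE : forall k, y k = H *m x k + v k.
Hypothesis aE : forall k, a k = G *m xhat k + eps k.

Lemma fwd_FE k : Ft k = (1%:M - E k *m H) *m F.
Proof.
rewrite /Ft /fwd_F /closed_loop /E /fwd_E /input_matrix; congr (_ *m _).
rewrite mulmxBr mulmx1 mulmxBl mul1mx mulmxDl mulmxBl !mulmxA.
by rewrite [in RHS]opprD addrA addrAC.
Qed.

Lemma fwd_est_evolution k :
  xhat k.+1 = Ft k *m xhat k + E k *m H *m x k.+1 + E k *m v k.+1.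
Proof.
have -> : xhat k.+1 = F *m xhat k + E k *m (y k.+1 - H *m (F *m xhat k)).
  rewrite /xhat /= -/(xhat k) -/(M k) -/(K k).
  set z := F *m xhat k; rewrite (mulmxDr H) opprD addrA.
  set d := y _ - _; rewrite (mulmxBr (K k)) /E /fwd_E /input_matrix.
  by rewrite -/(M k) -/(K k) mulmxDl mulmxBl !mulmxA -!addrA (addrC (K k *m d)).
rewrite (fwd_FE k) yE mulmxBr mulmxDr mulmxBl mul1mx mulmxBl !mulmxA.
move: (_ *m v _) (_ *m x _) (_ *m xhat k) (_ *m xhat k) => b c d e.
by apply/colP => i; rewrite !mxE; ring.
Qed.

Lemma fwd_error_recursion k :
  B^T *m H^T *m invmx (fwd_innov_cov F B H Q V Sigma0 k) *m H *m B \in unitmx ->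
  x k.+1 - xhat k.+1 =
    Ft k *m (x k - xhat k) + ((1%:M - E k *m H) *m w k - E k *m v k.+1).
Proof.
move=> uBS.
have MHB : M k *m H *m B = 1%:M.
  rewrite /M /fwd_M /step_M -/(fwd_innov_cov F B H Q V Sigma0 k).
  by rewrite -[RHS](mulVmx uBS) !mulmxA.
have EHB : E k *m H *m B = B.
  rewrite /E /fwd_E /input_matrix -/(M k) -/(K k) !mulmxDl !mulNmx.
  rewrite -!(mulmxA _ (M k)) -!(mulmxA _ _ B) !(mulmxA (M k)) MHB.
  by rewrite !mulmx1 subrK.
have -> : Ft k *m (x k - xhat k) =
    x k.+1 - E k *m H *m x k.+1 - (1%:M - E k *m H) *m w k - Ft k *m xhat k.
  rewrite mulmxBr; congr (_ - _); rewrite {1}fwd_FE.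
  have -> : x k.+1 - E k *m H *m x k.+1 = (1%:M - E k *m H) *m x k.+1.
    by rewrite mulmxBl mul1mx.
  rewrite xE !mulmxDr addrK mulmxA.
  by rewrite [X in _ = _ + X]mulmxA (mulmxBl _ _ B) mul1mx EHB subrr mul0mx addr0.
rewrite fwd_est_evolution !opprD !addrA; congr (_ - _).
rewrite [RHS]addrAC subrK; exact: addrAC.
Qed.

Lemma inv_error_recursion k :
  xhat k.+2 - xpred k.+1 =
    inv_error_matrix Ft E V G W bSigma0 k *m (xhat k.+1 - xpred k)
    + (E k.+1 *m v k.+2
       - Ft k.+1 *m inv_gain Ft E V G W bSigma0 k *m eps k.+1).
Proof.
rewrite fwd_est_evolution; set L := inv_gain _ _ _ _ _ _ k.
have -> : xpred k.+1 = Ft k.+1 *m (xpred k + L *m (a k.+1 - G *m xpred k))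
    + E k.+1 *m H *m x k.+2 by [].
rewrite aE /inv_error_matrix -/L; set s := xhat k.+1; set t := xpred k.
move: (Ft k.+1) (E k.+1) (L) (s) (t) (x k.+2) (v k.+2) (eps k.+1).
move=> F' E' L' s' t' x' v' eps'.
rewrite -[F' *m (_ - _) *m _]mulmxA mulmxBl mul1mx.
rewrite !(mulmxDr, mulmxN) !mulmxA.
move: (_ *m s') (_ *m s') (_ *m t') (_ *m t') (_ *m eps') (_ *m x') (_ *m v').
by move=> b c d e f g h; apply/colP => i; rewrite !mxE; ring.
Qed.

End ErrorDynamics.

(* Main.v *)
(* The one-step prediction covariances P_k of the inverse filter satisfy a
   Riccati recursion whose coefficients converge.  By duality, z^T P_m z is the
   optimal cost of a linear-quadratic problem run backwards from the terminal
   value z at time m, and the optimal trajectories are those of the transposed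
   error dynamics.  Observability of the limit gives cheap controls that steer
   the dual state close to zero in n steps, which bounds P_m.  Controllability
   of the limit and positivity of the measurement noise make the cost over n
   steps at least g |z|^2 with g > 0, whatever the control.  Hence n steps of
   the error dynamics A satisfy A P_(m-n) A^T <= rho P_m with rho < 1, and
   e_m e_m^T <= a P_m is improved by the factor rho every n steps. *)
Require Import Defs.
From mathcomp Require Import all_boot all_order all_algebra.
From mathcomp Require Import all_classical all_reals all_analysis.
From mathcomp Require Import ring lra zify.

Set Implicit Arguments.
Unset Strict Implicit.
Unset Printing Implicit Defensive.

Import Order.TTheory GRing.Theory Num.Theory.
Import numFieldNormedType.Exports.

Local Open Scope classical_set_scope.
Local Open Scope ring_scope.

(** * Bilinear and quadratic forms of matrices *)

Definition bilf (R : realType) (m n : nat) (A : 'M[R]_(m, n))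
    (x : 'cV[R]_m) (y : 'cV[R]_n) : R :=
  (x^T *m A *m y) 0 0.

Definition qf (R : realType) (n : nat) (A : 'M[R]_n) (x : 'cV[R]_n) : R :=
  bilf A x x.

Section BilinearForms.
Variables (R : realType) (m n : nat).
Implicit Types (A B : 'M[R]_(m, n)) (x : 'cV[R]_m) (y : 'cV[R]_n).

Lemma bilfDl A x x' y : bilf A (x + x') y = bilf A x y + bilf A x' y.
Proof. by rewrite /bilf linearD !mulmxDl mxE. Qed.

Lemma bilfDr A x y y' : bilf A x (y + y') = bilf A x y + bilf A x y'.
Proof. by rewrite /bilf !mulmxDr mxE. Qed.

Lemma bilfDm A B x y : bilf (A + B) x y = bilf A x y + bilf B x y.
Proof. by rewrite /bilf mulmxDr mulmxDl mxE. Qed.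

Lemma bilfNl A x y : bilf A (- x) y = - bilf A x y.
Proof. by rewrite /bilf linearN !mulNmx mxE. Qed.

Lemma bilfNr A x y : bilf A x (- y) = - bilf A x y.
Proof. by rewrite /bilf !mulmxN mxE. Qed.

Lemma bilfNm A x y : bilf (- A) x y = - bilf A x y.
Proof. by rewrite /bilf mulmxN mulNmx mxE. Qed.

Lemma bilfZl A a x y : bilf A (a *: x) y = a * bilf A x y.
Proof. by rewrite /bilf linearZ -!scalemxAl mxE. Qed.

Lemma bilfZr A a x y : bilf A x (a *: y) = a * bilf A x y.
Proof. by rewrite /bilf -!scalemxAr mxE. Qed.

Lemma bilf_tr A x y : bilf A x y = bilf (A^T) y x.
Proof.
by rewrite /bilf -[RHS]trace_mx11 -[LHS]trace_mx11 -mxtrace_tr !trmx_mul trmxK mulmxA.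
Qed.

Lemma bilf_mull k A (B : 'M[R]_(m, k)) (x : 'cV[R]_k) y :
  bilf A (B *m x) y = bilf (B^T *m A) x y.
Proof. by rewrite /bilf trmx_mul !mulmxA. Qed.

Lemma bilf_mulr k A (B : 'M[R]_(n, k)) x (y : 'cV[R]_k) :
  bilf A x (B *m y) = bilf (A *m B) x y.
Proof. by rewrite /bilf !mulmxA. Qed.

Lemma bilf_mulml k (A : 'M[R]_(m, k)) (B : 'M[R]_(k, n)) x y :
  bilf (A *m B) x y = bilf B (A^T *m x) y.
Proof. by rewrite /bilf trmx_mul trmxK !mulmxA. Qed.

End BilinearForms.

Lemma bilf_delta (R : realType) (m n : nat) (A : 'M[R]_(m, n)) i j :
  bilf A (delta_mx i 0) (delta_mx j 0) = A i j.
Proof.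
by rewrite /bilf trmx_delta -rowE -colE !mxE.
Qed.

(** * The maximum norm on matrices *)

Section EntrywiseNorm.
Variable R : realType.

Lemma mx_norm_entry (m n : nat) (A : 'M[R]_(m, n)) i j : `|A i j| <= `|A|.
Proof. by rewrite [leRHS]/Num.Def.normr /= mx_normrE; exact: (le_bigmax _ _ (i, j)). Qed.

Lemma mx_norm_le (m n : nat) (A : 'M[R]_(m, n)) (c : R) : 0 <= c ->
  (forall i j, `|A i j| <= c) -> `|A| <= c.
Proof.
by move=> c0 h; rewrite [leLHS]/Num.Def.normr /= mx_normrE; apply: bigmax_le => // -[i j] _.
Qed.

Lemma mx_norm_mul (m n k : nat) (A : 'M[R]_(m, n)) (B : 'M[R]_(n, k)) :
  `|A *m B| <= n%:R * (`|A| * `|B|).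
Proof.
apply: mx_norm_le; first by rewrite !mulr_ge0.
move=> i j; rewrite mxE (le_trans (ler_norm_sum _ _ _))//.
have h l : `|A i l * B l j| <= `|A| * `|B| by rewrite normrM ler_pM ?mx_norm_entry.
by rewrite (le_trans (ler_sum _ (fun l _ => h l)))// sumr_const card_ord mulr_natl.
Qed.

Lemma mx_norm_tr (m n : nat) (A : 'M[R]_(m, n)) : `|A^T| = `|A|.
Proof.
have h (k l : nat) (B : 'M[R]_(k, l)) : `|B^T| <= `|B|.
  by apply: mx_norm_le => // i j; rewrite mxE; exact: mx_norm_entry.
by apply/eqP; rewrite eq_le h; have := h _ _ A^T; rewrite trmxK => ->.
Qed.

Lemma bilf_norm_le (m n : nat) (A : 'M[R]_(m, n)) x y :
  `|bilf A x y| <= (n * m)%:R * (`|A| * (`|x| * `|y|)).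
Proof.
rewrite (le_trans (mx_norm_entry _ _ _))// (le_trans (mx_norm_mul _ _))//.
rewrite natrM -!mulrA ler_wpM2l//.
rewrite (le_trans (ler_wpM2r _ (mx_norm_mul _ _)))//.
by rewrite mx_norm_tr -!mulrA ler_wpM2l// mulrCA.
Qed.

End EntrywiseNorm.

(** * Semidefinite and definite forms, Cauchy-Schwarz and coercivity *)

Section PsdForms.
Variables (R : realType) (n : nat).
Implicit Types (P W : 'M[R]_n) (x y : 'cV[R]_n).

Lemma psd_sym P : psd P -> P^T = P.
Proof. by case. Qed.

Lemma psd_ge0 P x : psd P -> 0 <= qf P x.
Proof. by case=> _; apply. Qed.

Lemma posdef_psd W : posdef W -> psd W.
Proof.
move=> [Ws Wp]; split=> // x; have [->|x0] := eqVneq x 0.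
  by rewrite mulmx0 mxE.
exact/ltW/Wp.
Qed.

Lemma psdD P W : psd P -> psd W -> psd (P + W).
Proof.
move=> hP hW; split; first by rewrite linearD /= !psd_sym.
by move=> x; rewrite -/(bilf _ _ _) bilfDm addr_ge0// ?(psd_ge0 _ hP) ?(psd_ge0 _ hW).
Qed.

Lemma psd_congr (k : nat) (A : 'M[R]_(k, n)) P : psd P -> psd (A *m P *m A^T).
Proof.
move=> hP; split; first by rewrite !trmx_mul trmxK psd_sym// mulmxA.
move=> x; rewrite -/(bilf _ _ _) -bilf_mulr bilf_mulml.
exact: psd_ge0.
Qed.

(** The quadratic polynomial [t] -> [qf P (x + t *: y)] is nonnegative; since [P] may be singular,
    its leading coefficient [qf P y] may vanish. *)
Lemma psd_cauchy_schwarz P x y : psd P -> bilf P x y ^+ 2 <= qf P x * qf P y.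
Proof.
move=> hP; set b := bilf P x y.
have byx : bilf P y x = b by rewrite bilf_tr psd_sym.
have hq t : 0 <= qf P x + t * (b *+ 2) + t ^+ 2 * qf P y.
  have := psd_ge0 (x + t *: y) hP.
  rewrite /qf bilfDl !bilfDr !bilfZl !bilfZr byx -/b.
  suff -> : forall p q, p + t * b + (t * b + t * (t * q)) =
    p + t * (b *+ 2) + t ^+ 2 * q by [].
  by move=> p q; ring.
have [qy0|qy0] := eqVneq (qf P y) 0.
  rewrite qy0 mulr0; have [->|b0] := eqVneq b 0; first by rewrite expr0n.
  (* At this [t] the polynomial, which is affine here, takes the value -1. *)
  have := hq (- (qf P x + 1) / (b *+ 2)).
  rewrite qy0 mulr0 addr0 divfK ?mulrn_eq0//; lra.
have qyp : 0 < qf P y by rewrite lt_def qy0 psd_ge0.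
(* This [t] is the minimiser of the polynomial. *)
have := hq (- b / qf P y).
have -> : qf P x + - b / qf P y * (b *+ 2) + (- b / qf P y) ^+ 2 * qf P y =
   qf P x - b ^+ 2 / qf P y by field.
by rewrite subr_ge0 ler_pdivrMr.
Qed.

(** Cauchy-Schwarz on the basis vectors gives [P i j ^+ 2 <= P i i * P j j], so the diagonal
    controls all entries. *)
Lemma psd_norm_le_diag P (c : R) : psd P -> 0 <= c ->
  (forall i, P i i <= c) -> `|P| <= c.
Proof.
move=> hP c0 hd; apply: mx_norm_le => // i j.
have := @psd_cauchy_schwarz P (delta_mx i 0) (delta_mx j 0) hP.
rewrite /qf !bilf_delta => h.
have d0 l : 0 <= P l l by rewrite -bilf_delta; exact: psd_ge0.
rewrite -(@ler_pXn2r _ 2)// ?nnegrE// -normrX ger0_norm ?sqr_ge0//.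
by rewrite (le_trans h)// expr2 ler_pM.
Qed.

Lemma posdef_unitmx W : posdef W -> W \in unitmx.
Proof.
move=> [Ws Wp]; rewrite -row_free_unit -kermx_eq0; apply/rowV0P => v /sub_kermxP vW.
apply/eqP; apply/negPn/negP => v0.
have := Wp v^T; rewrite trmxK vW mul0mx mxE ltxx => /(_ _)/notF; apply.
by rewrite -trmx0 (inj_eq trmx_inj).
Qed.

(** Cauchy-Schwarz for [W] between [W^-1 e_i] and [x] bounds [x_i ^+ 2] by [(W^-1)_ii * qf W x]. The
    summand 1 in the constant makes it strictly positive. *)
Lemma posdef_coercive W : posdef W ->
  exists2 c : R, 0 < c & forall x, `|x| ^+ 2 <= c * qf W x.
Proof.
move=> hW; have uW := posdef_unitmx hW; have sW := posdef_psd hW.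
exists (1 + `|invmx W|); first by rewrite ltr_pwDl.
move=> x; have qx := psd_ge0 x sW.
have key i : x i 0 ^+ 2 <= (1 + `|invmx W|) * qf W x.
  have := @psd_cauchy_schwarz W (invmx W *m delta_mx i 0) x sW.
  have -> : bilf W (invmx W *m delta_mx i 0) x = x i 0.
    by rewrite bilf_mull trmx_inv psd_sym// mulVmx// /bilf mulmx1
      trmx_delta -rowE mxE.
  have -> : qf W (invmx W *m delta_mx i 0) = invmx W i i.
    by rewrite /qf bilf_mull trmx_inv psd_sym// mulVmx// bilf_mulr mul1mx bilf_delta.
  move=> /le_trans; apply; apply: ler_wpM2r => //.
  rewrite (le_trans (ler_norm _))// (le_trans (mx_norm_entry _ _ _))//.
  by rewrite lerDr.
have c0 : 0 <= (1 + `|invmx W|) * qf W x by rewrite mulr_ge0.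
rewrite -[leRHS]sqr_sqrtr// ler_pXn2r ?nnegrE ?sqrtr_ge0//.
apply: mx_norm_le; first exact: sqrtr_ge0.
by move=> i j; rewrite ord1 -sqrtr_sqr ler_sqrt.
Qed.

End PsdForms.

(** * The rank conditions as one-sided inverses *)

Section KalmanRank.
Variables (R : realType) (n q : nat).

Lemma observable_left_inverse (F : 'M[R]_n) (G : 'M[R]_(q, n)) :
  observable F G ->
  exists X : nat -> 'M[R]_(n, q), \sum_(i < n) X i *m (G *m F ^+ i) = 1%:M.
Proof.
move=> /eqP/row_fullP[B hB].
(* The blocks of the left inverse are extended by 0 to all of [nat], so that they can later be
   indexed by differences. *)
exists (fun i => if insub i is Some j then submxrow B j else 0).
rewrite -hB -[B in RHS]submxrowK mul_mxrow_mxcol.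
by apply: eq_bigr => i _; rewrite valK.
Qed.

Lemma controllable_right_inverse (F : 'M[R]_n) (C : 'M[R]_(n, q)) :
  controllable F C ->
  exists Y : 'I_n -> 'M[R]_(q, n), \sum_(i < n) F ^+ i *m C *m Y i = 1%:M.
Proof.
move=> /eqP/row_freeP[B hB]; exists (submxcol B).
by rewrite -hB -[B in RHS]submxcolK mul_mxrow_mxcol.
Qed.

End KalmanRank.

(** * Limits of matrix-valued functions *)

Section MatrixLimits.
Variables (R : realType) (T : Type) (Fl : set_system T).
Context {FF : Filter Fl}.

Lemma cvg_mxP (m n : nat) (A : T -> 'M[R]_(m, n)) (A0 : 'M[R]_(m, n)) :
  A @ Fl --> A0 <-> forall i j, A t i j @[t --> Fl] --> A0 i j.
Proof.
split=> [hA i j|hA].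
  exact: (@cvg_comp _ _ _ A (fun M : 'M[R]_(m, n) => M i j) _ _ _ hA
    (@coord_continuous _ _ _ i j A0)).
apply/cvgrPdist_le => e e0.
have : \forall t \near Fl, forall i j, `|A0 i j - A t i j| <= e.
  apply: filter_forall => i; apply: filter_forall => j.
  exact: (@cvgrPdist_le _ _ _ _ _ _ _).1 (hA i j) e e0.
apply: filterS => t h; apply: mx_norm_le (ltW e0) _ => i j.
by rewrite !mxE.
Qed.

Lemma cvg_mulmx (m n k : nat) (A : T -> 'M[R]_(m, n)) (B : T -> 'M[R]_(n, k))
    (A0 : 'M[R]_(m, n)) (B0 : 'M[R]_(n, k)) :
  A @ Fl --> A0 -> B @ Fl --> B0 -> A t *m B t @[t --> Fl] --> A0 *m B0.
Proof.
move=> /cvg_mxP hA /cvg_mxP hB; apply/cvg_mxP => i j.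
under eq_fun do rewrite mxE.
rewrite mxE; apply: cvg_big => [|l _]; first exact: add_continuous.
exact: cvgM.
Qed.

Lemma cvg_trmx (m n : nat) (A : T -> 'M[R]_(m, n)) (A0 : 'M[R]_(m, n)) :
  A @ Fl --> A0 -> (A t)^T @[t --> Fl] --> A0^T.
Proof.
move=> /cvg_mxP hA; apply/cvg_mxP => i j.
rewrite mxE; under eq_fun do rewrite mxE.
exact: hA.
Qed.

Lemma cvg_bilf (m n : nat) (A : T -> 'M[R]_(m, n)) (x : T -> 'cV[R]_m)
    (y : T -> 'cV[R]_n) (A0 : 'M[R]_(m, n)) (x0 : 'cV[R]_m) (y0 : 'cV[R]_n) :
  A @ Fl --> A0 -> x @ Fl --> x0 -> y @ Fl --> y0 ->
  bilf (A t) (x t) (y t) @[t --> Fl] --> bilf A0 x0 y0.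
Proof.
move=> hA hx hy.
have /cvg_mxP : (x t)^T *m A t *m y t @[t --> Fl] --> x0^T *m A0 *m y0.
  by apply: cvg_mulmx => //; apply: cvg_mulmx => //; exact: cvg_trmx.
exact.
Qed.

Lemma cvg0_norm_le (V : normedModType R) (f : T -> V) (g : T -> R) :
  (\forall t \near Fl, `|f t| <= g t) -> g @ Fl --> (0 : R) -> f @ Fl --> (0 : V).
Proof.
move=> fg g0; apply/norm_cvg0P; apply: (@squeeze_cvgr _ _ _ _ (cst 0) g) => //.
- by near=> t; rewrite normr_ge0 /=; near: t.
- exact: cvg_cst.
Unshelve. all: by end_near. Qed.

Lemma cvg0_mulmx_bounded (m n k : nat) (A : T -> 'M[R]_(m, n))
    (B : T -> 'M[R]_(n, k)) (c : R) :
  A @ Fl --> (0 : 'M[R]_(m, n)) -> (\forall t \near Fl, `|B t| <= c) ->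
  A t *m B t @[t --> Fl] --> (0 : 'M[R]_(m, k)).
Proof.
move=> hA hB; apply: (@cvg0_norm_le _ _ (fun t => n%:R * c * `|A t|)).
  near=> t; rewrite (le_trans (mx_norm_mul _ _))// -mulrA ler_wpM2l//.
  by rewrite mulrC ler_wpM2r//; near: t.
rewrite -[0](mulr0 (n%:R * c)); apply: cvgMr.
by rewrite -[0](normr0 'M[R]_(m, n)); exact: cvg_norm.
Unshelve. all: by end_near. Qed.

Lemma cvg0_sqr (f : T -> R) : f t ^+ 2 @[t --> Fl] --> (0 : R) -> f @ Fl --> (0 : R).
Proof.
move=> hf; apply/norm_cvg0P.
rewrite -[0]sqrtr0; under eq_fun do rewrite -sqrtr_sqr.
exact: (continuous_cvg _ (@sqrt_continuous _ _)).
Qed.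

End MatrixLimits.

(** * The dual linear-quadratic problem *)

Section DualTrajectories.
Variables (R : realType) (n q : nat).
Variables (F : nat -> 'M[R]_n) (G : 'M[R]_(q, n)).

(* Index [i] counts time backwards from the terminal time [m]: [z i] is the
   adjoint state at time [m - i], so only windows [N <= m] make sense. *)
Definition dual_trajectory (N m : nat) (z : nat -> 'cV[R]_n)
    (u : nat -> 'cV[R]_q) : Prop :=
  forall i, (i < N)%N -> z i.+1 = (F (m - i.+1)%N)^T *m z i - G^T *m u i.

Definition dual_cost (Q : nat -> 'M[R]_n) (W : 'M[R]_q) (N m : nat)
    (z : nat -> 'cV[R]_n) (u : nat -> 'cV[R]_q) : R :=
  \sum_(i < N) (qf W (u i) + qf (Q (m - i.+1)%N) (z i)).

Lemma dual_trajectoryZ N m z u (a : R) : dual_trajectory N m z u ->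
  dual_trajectory N m (fun i => a *: z i) (fun i => a *: u i).
Proof. by move=> h i iN; rewrite -!scalemxAr -scalerBr h. Qed.

Lemma dual_costZ Q W N m z u (a : R) :
  dual_cost Q W N m (fun i => a *: z i) (fun i => a *: u i) =
  a ^+ 2 * dual_cost Q W N m z u.
Proof.
rewrite /dual_cost mulr_sumr; apply: eq_bigr => i _.
by rewrite /qf !bilfZl !bilfZr mulrDr !mulrA expr2.
Qed.

Lemma dual_cost_ge_term Q W N m z u i : (forall k, psd (Q k)) -> psd W ->
  (i < N)%N ->
  qf W (u i) + qf (Q (m - i.+1)%N) (z i) <= dual_cost Q W N m z u.
Proof.
move=> hQ hW iN; rewrite /dual_cost (bigD1 (Ordinal iN))//= lerDl.
by apply: sumr_ge0 => j _; rewrite addr_ge0// psd_ge0.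
Qed.

End DualTrajectories.

(** Since [k <= m k], the truncated difference [m k - j] still tends to infinity. *)
Lemma cvg_subn (T : topologicalType) (A : nat -> T) (A0 : T)
    (j : nat) (m : nat -> nat) :
  (forall k, (k <= m k)%N) -> A @ \oo --> A0 -> A (m k - j)%N @[k --> \oo] --> A0.
Proof.
move=> hm hA; apply: (@cvg_comp _ _ _ (fun k => (m k - j)%N) A _ _ _ _ hA).
move=> U [N _ NU]; exists (N + j)%N => // k /= hk; apply: NU => /=.
by have := hm k; lia.
Qed.

Lemma qf_gram (R : realType) (n c : nat) (C : 'M[R]_(n, c)) (x : 'cV[R]_n) :
  qf (C *m C^T) x = \sum_j (C^T *m x) j 0 ^+ 2.
Proof.
rewrite /qf -bilf_mulr /bilf -[x^T *m C]trmxK trmx_mul trmxK mxE.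
by apply: eq_bigr => j _; rewrite mxE expr2.
Qed.

(** * Coercivity of the dual cost under controllability *)

Section Gramian.
Variables (R : realType) (n q c : nat).
Variables (F : nat -> 'M[R]_n) (Fbar : 'M[R]_n) (G : 'M[R]_(q, n)).
Variables (Q : nat -> 'M[R]_n) (W : 'M[R]_q) (C : 'M[R]_(n, c)).
Hypotheses (cvgF : F @ \oo --> Fbar) (psdQ : forall k, psd (Q k)).
Hypotheses (cvgQ : Q @ \oo --> C *m C^T) (posW : posdef W).
Hypothesis ctrl : controllable Fbar C.

(* With vanishing inputs the trajectory follows the powers of [Fbar^T], so a
   vanishing state cost makes all the [C^T (Fbar^i)^T z_0] vanish, and
   controllability recovers [z_0] from these. *)
Lemma dual_cost_vanishing (m : nat -> nat) (z : nat -> nat -> 'cV[R]_n)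
    (u : nat -> nat -> 'cV[R]_q) :
  (forall k, (k <= m k)%N) ->
  (forall k, dual_trajectory F G n (m k) (z k) (u k)) ->
  (forall k, `|z k 0%N| <= 1) ->
  dual_cost Q W n (m k) (z k) (u k) @[k --> \oo] --> (0 : R) ->
  z k 0%N @[k --> \oo] --> (0 : 'cV[R]_n).
Proof.
move=> hm traj z1 cost0.
have psdW := posdef_psd posW.
have u0 i : (i < n)%N -> u k i @[k --> \oo] --> (0 : 'cV[R]_q).
  move=> iN; have [b b0 hb] := posdef_coercive posW.
  apply/norm_cvg0P; apply: cvg0_sqr.
  apply: (@cvg0_norm_le _ _ _ _ _ _ (fun k => b * dual_cost Q W n (m k) (z k) (u k))).
    apply: nearW => k /=; rewrite ger0_norm ?sqr_ge0// (le_trans (hb _))//.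
    apply: ler_wpM2l; first exact: ltW.
    apply: le_trans; last first.
      exact: (@dual_cost_ge_term _ _ _ _ _ _ _ _ _ i psdQ psdW).
    by rewrite lerDl psd_ge0.
  by rewrite -[0](mulr0 b); exact: cvgMr.
have Qz0 i : (i < n)%N -> qf (Q (m k - i.+1)%N) (z k i) @[k --> \oo] --> (0 : R).
  move=> iN; apply: (@cvg0_norm_le _ _ _ _ _ _ _ _ cost0).
  apply: nearW => k /=; rewrite ger0_norm ?psd_ge0//.
  apply: le_trans; last first.
    exact: (@dual_cost_ge_term _ _ _ _ _ _ _ _ _ i psdQ psdW).
  by rewrite lerDr psd_ge0.
have d0 i : (i <= n)%N ->
    z k i - (Fbar ^+ i)^T *m z k 0%N @[k --> \oo] --> (0 : 'cV[R]_n).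
  elim: i => [_|i IH iN].
    under eq_fun do rewrite expr0 trmx1 mul1mx subrr.
    exact: cvg_cst.
  (* The deviation from the free limiting motion is carried along by [F^T] and receives two
     vanishing terms: the coefficient error applied to the bounded [z k 0], and the input. *)
  have -> : (fun k => z k i.+1 - (Fbar ^+ i.+1)^T *m z k 0%N) =
     (fun k => (F (m k - i.+1)%N)^T *m (z k i - (Fbar ^+ i)^T *m z k 0%N)
       + ((F (m k - i.+1)%N)^T - Fbar^T) *m (Fbar ^+ i)^T *m z k 0%N
       - G^T *m u k i).
    apply/funext => k; rewrite traj// mulmxBr exprSr trmx_mul !mulmxBl !mulmxA.
    move: (_ *m z k i) (_ *m z k 0%N) (_ *m z k 0%N) (_ *m u _ _) => v1 v2 v3 v4.
    by apply/colP => l; rewrite !mxE; ring.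
  have hF : (F (m k - i.+1)%N)^T @[k --> \oo] --> Fbar^T.
    by apply: cvg_trmx; exact: cvg_subn.
  rewrite -[0](subr0 (0 : 'cV[R]_n)); apply: cvgB; last first.
    rewrite -[0](mulmx0 _ G^T); apply: cvg_mulmx; first exact: cvg_cst.
    exact: u0.
  rewrite -[0](addr0 (0 : 'cV[R]_n)); apply: cvgD.
    rewrite -[0](mulmx0 _ Fbar^T); apply: cvg_mulmx => //.
    by apply: IH; exact: ltnW.
  apply: (@cvg0_mulmx_bounded _ _ _ _ _ _ _ _ _ 1); last exact: nearW.
  rewrite -[0](mul0mx _ (Fbar ^+ i)^T); apply: cvg_mulmx; last exact: cvg_cst.
  by rewrite -(subrr Fbar^T); apply: cvgB => //; exact: cvg_cst.
have Cz0 i : (i < n)%N ->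
    C^T *m ((Fbar ^+ i)^T *m z k 0%N) @[k --> \oo] --> (0 : 'cV[R]_c).
  move=> iN.
  (* Boundedness of the state allows replacing [Q] by its limit [C *m C^T] in the vanishing state
     cost. *)
  have : \forall k \near \oo, `|z k i| <= 1 + n%:R * `|(Fbar ^+ i)^T|.
    have /cvgr0Pnorm_le /(_ 1 ltr01) := d0 i (ltnW iN).
    apply: filterS => k hk.
    rewrite -(subrK ((Fbar ^+ i)^T *m z k 0%N) (z k i)) (le_trans (ler_normD _ _))//.
    rewrite lerD// (le_trans (mx_norm_mul _ _))// ler_wpM2l//.
    by rewrite ler_piMr.
  set b := 1 + _ => hb.
  have b0 : 0 <= b by rewrite addr_ge0// mulr_ge0.
  have CCz : qf (C *m C^T) (z k i) @[k --> \oo] --> (0 : R).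
    have -> : (fun k => qf (C *m C^T) (z k i)) = (fun k =>
        qf (Q (m k - i.+1)%N) (z k i)
        + bilf (C *m C^T - Q (m k - i.+1)%N) (z k i) (z k i)).
      by apply/funext => k; rewrite /qf bilfDm bilfNm addrC subrK.
    rewrite -[0](addr0 (0 : R)); apply: cvgD; first exact: Qz0.
    apply: (@cvg0_norm_le _ _ _ _ _ _
      (fun k => (n * n)%:R * (b * b) * `|C *m C^T - Q (m k - i.+1)%N|)).
      apply: filterS hb => k hk; rewrite (le_trans (bilf_norm_le _ _ _))//.
      rewrite -mulrA ler_wpM2l// mulrC ler_wpM2r//.
      by rewrite ler_pM.
    rewrite -[0](mulr0 ((n * n)%:R * (b * b))); apply: cvgMr.
    apply/norm_cvg0P; rewrite -(subrr (C *m C^T)); apply: cvgB; first exact: cvg_cst.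
    exact: cvg_subn.
  have Cz : C^T *m z k i @[k --> \oo] --> (0 : 'cV[R]_c).
    apply/cvg_mxP => j l; rewrite mxE; apply: cvg0_sqr.
    apply: (@cvg0_norm_le _ _ _ _ _ _ _ _ CCz).
    apply: nearW => k /=; rewrite ger0_norm ?sqr_ge0//.
    rewrite qf_gram (ord1 l) (bigD1 j)//= lerDl.
    by apply: sumr_ge0 => l' _; exact: sqr_ge0.
  have -> : (fun k => C^T *m ((Fbar ^+ i)^T *m z k 0%N)) =
     (fun k => C^T *m z k i - C^T *m (z k i - (Fbar ^+ i)^T *m z k 0%N)).
    by apply/funext => k; rewrite mulmxBr opprB addrC subrK.
  rewrite -[0](subr0 (0 : 'cV[R]_c)); apply: cvgB => //.
  rewrite -[0](mulmx0 _ C^T); apply: cvg_mulmx; first exact: cvg_cst.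
  exact/d0/ltnW.
have [Y hY] := controllable_right_inverse ctrl.
have -> : (fun k => z k 0%N) =
   (fun k => \sum_(i < n) (Y i)^T *m (C^T *m ((Fbar ^+ i)^T *m z k 0%N))).
  apply/funext => k; rewrite -[LHS]mul1mx -trmx1 -hY linear_sum mulmx_suml.
  by apply: eq_bigr => i _; rewrite /= !trmx_mul !mulmxA.
have sum0 : \sum_(i < n) (0 : 'cV[R]_n) = 0 by rewrite big1.
rewrite -[X in _ --> X]sum0; apply: cvg_big => [|i _]; first exact: add_continuous.
rewrite -[0](mulmx0 _ (Y i)^T); apply: cvg_mulmx; first exact: cvg_cst.
exact: Cz0.
Qed.

(** If every [g] fails, normalising counterexamples to [|z 0| = 1], by homogeneity of the cost,
    gives trajectories at times tending to infinity whose costs vanish; this contradicts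
    [dual_cost_vanishing]. *)
Lemma dual_cost_coercive : exists2 g : R, 0 < g &
  \forall m \near \oo, forall z u, dual_trajectory F G n m z u ->
    g * `|z 0%N| ^+ 2 <= dual_cost Q W n m z u.
Proof.
have psdW := posdef_psd posW.
apply: contrapT => hno.
have hk (k : nat) : exists mzu : nat * (nat -> 'cV[R]_n) * (nat -> 'cV[R]_q),
    [/\ (k <= mzu.1.1)%N, dual_trajectory F G n mzu.1.1 mzu.1.2 mzu.2,
      `|mzu.1.2 0%N| = 1 & dual_cost Q W n mzu.1.1 mzu.1.2 mzu.2 < k.+1%:R^-1].
  (* If no normalised counterexample exists at level [k], then [1 / (k+1)] is a coercivity constant
     from time [k] on. *)
  apply: contrapT => hk; apply: hno; exists k.+1%:R^-1 => //.
  exists k => // m /= km z u zu; rewrite leNgt; apply/negP => hlt.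
  have cost0 : 0 <= dual_cost Q W n m z u.
    by apply: sumr_ge0 => i _; rewrite addr_ge0// psd_ge0.
  have z0 : 0 < `|z 0%N|.
    rewrite lt_def normr_ge0 andbT; apply/eqP => z0.
    by move: hlt; rewrite z0 expr0n mulr0 ltNge cost0.
  apply: hk; exists (m, (fun i => `|z 0%N|^-1 *: z i), (fun i => `|z 0%N|^-1 *: u i)).
  split => //=; first exact: dual_trajectoryZ.
    by rewrite normrZ ger0_norm ?invr_ge0// mulVf// gt_eqF.
  rewrite dual_costZ exprVn mulrC ltr_pdivrMr ?exprn_gt0//.
have {hk} [s hs] := choice hk.
have : (s k).1.2 0%N @[k --> \oo] --> (0 : 'cV[R]_n).
  apply: (@dual_cost_vanishing (fun k => (s k).1.1) (fun k => (s k).1.2)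
    (fun k => (s k).2)).
  - by move=> k; have [] := hs k.
  - by move=> k; have [] := hs k.
  - by move=> k; have [_ _ ->] := hs k.
  - apply: (@cvg0_norm_le _ _ _ _ _ _ _ _ (@cvg_harmonic R)).
    apply: nearW => k; have [_ _ _ h] := hs k.
    rewrite ger0_norm ?(ltW h)//.
    by apply: sumr_ge0 => i _; rewrite addr_ge0// psd_ge0.
move=> /cvgr0Pnorm_lt /(_ 1 ltr01) [N _ /(_ N (leqnn N))] /=.
by have [_ _ ->] := hs N; rewrite ltxx.
Qed.

End Gramian.

(** The transposed left inverse of the observability matrix writes the free response
    [(F ^+ n)^T *m z] as a sum of terms [(F ^+ i)^T *m G^T *m u], which the controls then cancel. *)
Lemma dead_beat_control (R : realType) (n q : nat) (F : 'M[R]_n)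
    (G : 'M[R]_(q, n)) (z : 'cV[R]_n) :
  observable F G -> exists zb : nat -> 'cV[R]_n, exists u : nat -> 'cV[R]_q,
    [/\ zb 0%N = z, zb n = 0 &
        forall i, zb i.+1 = F^T *m zb i - G^T *m u i].
Proof.
move=> /observable_left_inverse[X hX].
(* The order is reversed because the control at step [l] reaches the final state through
   [F ^+ (n - l.+1)]. *)
pose u i := (X (n - i.+1)%N)^T *m ((F ^+ n)^T *m z).
pose zb i := (F ^+ i)^T *m z - \sum_(l < i) (F ^+ (i - l.+1))^T *m (G^T *m u l).
exists zb, u; split.
- by rewrite /zb big_ord0 subr0 expr0 trmx1 mul1mx.
- rewrite /zb (reindex_inj rev_ord_inj) /=.
  apply/eqP; rewrite subr_eq0; apply/eqP.
  rewrite -[LHS]mul1mx -trmx1 -hX linear_sum mulmx_suml.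
  apply: eq_bigr => i _; rewrite /u /= !trmx_mul !mulmxA.
  have ii : (n - (n - i.+1).+1 = i)%N by have := ltn_ord i; lia.
  by rewrite ii.
- move=> i; rewrite /zb big_ord_recr /= subnn expr0 trmx1 mul1mx opprD addrA.
  congr (_ - _); rewrite mulmxBr exprSr trmx_mul mulmxA; congr (_ - _).
  rewrite mulmx_sumr; apply: eq_bigr => l _.
  have -> : (i.+1 - l.+1 = (i - l.+1).+1)%N by have := ltn_ord l; lia.
  by rewrite exprSr trmx_mul !mulmxA.
Qed.

(** The map [t] -> [t / 2 + r] preserves any upper bound that is at least [2 * r]; the finitely many
    initial values enter the bound through their sum. *)
Lemma bounded_of_half_step (R : realType) (N : nat) (r : R) (a : nat -> R) :
  (forall k, 0 <= a k) ->
  (\forall m \near \oo, (N <= m)%N && (a m <= a (m - N)%N / 2 + r)) ->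
  exists c : R, forall m, a m <= c.
Proof.
move=> a0 [M _ hM].
have r0 m : (M <= m)%N -> a m <= a (m - N)%N / 2 + r by move=> /hM /andP[].
exists (\sum_(j < M) a j + 2 * `|r|) => m.
have sum0 : 0 <= \sum_(j < M) a j by exact: sumr_ge0.
have rle := ler_norm r; have rge := normr_ge0 r.
elim/ltn_ind: m => m IH.
have [mM|Mm] := ltnP m M.
  rewrite (bigD1 (Ordinal mM))//= -addrA lerDl addr_ge0//; exact: sumr_ge0.
(* If [N = 0] or [m = 0], then [m - N = m] and induction does not apply, but the inequality itself
   gives [a m <= 2 * r]. *)
have [Nm0|Nm0] := posnP N.
  have := r0 _ Mm; rewrite Nm0 subn0; lra.
have [m0|m0] := posnP m; first by have := r0 _ Mm; rewrite m0 sub0n; lra.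
have := IH (m - N)%N; rewrite ltn_subrL Nm0 m0 => /(_ isT).
have := r0 _ Mm; lra.
Qed.

(** * The Riccati recursion *)

Section Riccati.
Variables (R : realType) (n q : nat).
Variables (F : nat -> 'M[R]_n) (G : 'M[R]_(q, n)).
Variables (Q : nat -> 'M[R]_n) (W : 'M[R]_q) (P : nat -> 'M[R]_n).
Hypotheses (psdQ : forall k, psd (Q k)) (posW : posdef W).

Let S k := G *m P k *m G^T + W.

Definition kalman_gain k : 'M[R]_(n, q) := P k *m G^T *m invmx (S k).

Let L := kalman_gain.

Hypothesis psdP0 : psd (P 0%N).
Hypothesis PE : forall k,
  P k.+1 = F k *m (P k - L k *m G *m P k) *m (F k)^T + Q k.

Let posS k : psd (P k) -> posdef (S k).
Proof.
move=> hP; split; first by case: (psdD (psd_congr G hP) (posdef_psd posW)).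
move=> x x0; rewrite -/(bilf _ _ _) bilfDm ltr_wpDl//; last exact: posW.2.
exact: (psd_ge0 _ (psd_congr G hP)).
Qed.

(** This characterises the gain without the inverse of [S k]; the Riccati computations below use the
    gain only in this form. *)
Let mul_innov_gain k : psd (P k) -> S k *m (L k)^T = G *m P k.
Proof.
move=> hP; have [sS _] := posS hP; have uS := posdef_unitmx (posS hP).
by rewrite /L /kalman_gain !trmx_mul trmx_inv trmxK sS (psd_sym hP) mulKVmx.
Qed.

(* Completion of the square: [z^T P_(k+1) z] is the minimum over [u] of the
   right-hand side, attained at [u = L_k^T F_k^T z]. *)
Lemma riccati_step k (z : 'cV[R]_n) (u : 'cV[R]_q) : psd (P k) ->
  qf (P k.+1) z + qf (S k) (u - (L k)^T *m ((F k)^T *m z)) =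
  qf (P k) ((F k)^T *m z - G^T *m u) + (qf W u + qf (Q k) z).
Proof.
move=> hP; have [sS _] := posS hP; have sP := psd_sym hP.
move: (L k) (mul_innov_gain hP) (PE k) => Lk SL PEk.
set xi := (F k)^T *m z; set l := Lk^T *m xi.
have h1 : qf (P k.+1) z = qf (P k) xi - qf (S k) l + qf (Q k) z.
  rewrite {1}/qf PEk bilfDm -bilf_mulr bilf_mulml bilfDm bilfNm.
  by rewrite -mulmxA -SL bilf_mulml -bilf_mulr.
have h2 : bilf (S k) u l = bilf (P k) (G^T *m u) xi.
  by rewrite bilf_mulr SL bilf_mulml.
have h3 : qf (S k) u = qf (P k) (G^T *m u) + qf W u.
  by rewrite /qf bilfDm -bilf_mulr bilf_mulml.
rewrite h1 {h1}; rewrite /qf in h3 *.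
rewrite !(bilfDl, bilfDr, bilfNl, bilfNr) h3.
rewrite (bilf_tr _ l u) sS h2 (bilf_tr _ xi (G^T *m u)) sP.
ring.
Qed.

Lemma riccati_psd k : psd (P k).
Proof.
elim: k => // k hP; have sP := psd_sym hP; split.
  rewrite PE linearD /= (psd_sym (psdQ k)); congr (_ + _).
  rewrite !trmx_mul trmxK mulmxA; congr (_ *m _ *m _).
  have [sS _] := posS hP; move: (L k) (mul_innov_gain hP) => Lk SL.
  by rewrite linearB /= sP -!mulmxA -SL !trmx_mul trmxK sS mulmxA.
move=> z; change (0 <= qf (P k.+1) z).
have qf0 : qf (S k) 0 = 0 by rewrite /qf /bilf mulmx0 mxE.
(* At the minimising control the completed square vanishes, which leaves [qf (P k.+1) z] as a sum of
   nonnegative terms. *)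
have := riccati_step z ((L k)^T *m ((F k)^T *m z)) hP.
rewrite subrr qf0 addr0 => ->.
by rewrite !addr_ge0 ?psd_ge0//; exact: posdef_psd.
Qed.

(** Summing [riccati_step] along the trajectory telescopes; the sum of squares on the left is the
    excess over the optimal cost. *)
Lemma riccati_dual_cost N m z u : (N <= m)%N -> dual_trajectory F G N m z u ->
  qf (P m) (z 0%N) + \sum_(i < N) qf (S (m - i.+1)%N)
    (u i - (L (m - i.+1)%N)^T *m ((F (m - i.+1)%N)^T *m z i)) =
  qf (P (m - N)%N) (z N) + dual_cost Q W N m z u.
Proof.
elim: N => [|N IH] Nm traj.
  by rewrite /dual_cost !big_ord0 subn0.
rewrite /dual_cost !big_ord_recr /= -/(dual_cost _ _ _ _ _ _) addrA.
rewrite IH ?(ltnW Nm)//; last by move=> i iN; apply: traj; exact: ltnW.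
have -> : (m - N = (m - N.+1).+1)%N by lia.
rewrite traj// addrAC riccati_step; last exact: riccati_psd.
ring.
Qed.

Lemma riccati_le_dual_cost N m z u : (N <= m)%N -> dual_trajectory F G N m z u ->
  qf (P m) (z 0%N) <= qf (P (m - N)%N) (z N) + dual_cost Q W N m z u.
Proof.
move=> Nm traj; rewrite -(riccati_dual_cost Nm traj) lerDl.
apply: sumr_ge0 => i _; apply: psd_ge0; apply: posdef_psd; apply: posS.
exact: riccati_psd.
Qed.

(** The transposed error dynamics are the dual dynamics under the feedback that makes every
    completed square vanish, so their cost is optimal. *)
Lemma riccati_closed_loop N m z : (N <= m)%N ->
  (forall i, (i < N)%N -> z i.+1 =
    (F (m - i.+1)%N *m (1%:M - L (m - i.+1)%N *m G))^T *m z i) ->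
  let u := fun i => (L (m - i.+1)%N)^T *m ((F (m - i.+1)%N)^T *m z i) in
  dual_trajectory F G N m z u /\
  qf (P m) (z 0%N) = qf (P (m - N)%N) (z N) + dual_cost Q W N m z u.
Proof.
move=> Nm hz u; have traj : dual_trajectory F G N m z u.
  move=> i iN; rewrite hz// /u trmx_mul linearB /= trmx1 trmx_mul -mulmxA.
  by rewrite mulmxBl mul1mx !mulmxA.
split=> //; rewrite -(riccati_dual_cost Nm traj) big1 ?addr0// => i _.
by rewrite /u subrr /qf /bilf mulmx0 mxE.
Qed.

Variables (Fbar Qbar : 'M[R]_n).
Hypotheses (cvgF : F @ \oo --> Fbar) (cvgQ : Q @ \oo --> Qbar).

(* The controls that steer the limiting dual system to zero in [n] steps are
   suboptimal for the dual problem at time [m]; they leave a terminal state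
   that tends to zero with [m], hence [|P_m| <= |P_(m-n)| / 2 + r]. *)
Lemma riccati_bounded : observable Fbar G -> exists b : R, forall m, `|P m| <= b.
Proof.
move=> obs.
have key (i : 'I_n) : exists r : R,
    \forall m \near \oo, P m i i <= `|P (m - n)%N| / 2 + r.
  have [zb [u [zb0 zbn zbS]]] := dead_beat_control (delta_mx i 0) obs.
  (* The dead-beat controls of the limiting system are applied to the actual system that ends at
     time [m]. *)
  pose zt m := fix t j := if j is l.+1
    then (F (m - l.+1)%N)^T *m t l - G^T *m u l else delta_mx i 0.
  have cvgzt j : zt m j @[m --> \oo] --> zb j.
    elim: j => [|j IH] /=; first by rewrite zb0; exact: cvg_cst.
    rewrite zbS; apply: cvgB; last exact: cvg_cst.
    by apply: cvg_mulmx => //; apply: cvg_trmx; exact: cvg_subn.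
  have cvgcost : dual_cost Q W n m (zt m) u @[m --> \oo] -->
      \sum_(j < n) (qf W (u j) + qf Qbar (zb j)).
    apply: cvg_big => [|j _]; first exact: add_continuous.
    apply: cvgD; first exact: cvg_cst.
    by apply: cvg_bilf => //; exact: cvg_subn.
  (* This factor multiplies [|P (m - n)|] in the bound on the terminal cost; being eventually at
     most 1/2, it yields the contraction. *)
  have cvg2 : (n * n)%:R * (`|zt m n| * `|zt m n|) @[m --> \oo] --> (0 : R).
    have cvgn : `|zt m n| @[m --> \oo] --> (0 : R).
      by apply/norm_cvg0P; rewrite -zbn.
    rewrite -[0](mulr0 (n * n)%:R) -[in X in _ --> X](mulr0 (0 : R)).
    by apply: cvgMr; exact: cvgM.
  set l := \sum_(j < n) _ in cvgcost.
  exists (l + 1).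
  have half0 : (0 : R) < 2^-1 by rewrite invr_gt0.
  near=> m.
  rewrite -bilf_delta -/(qf _ _).
  have nm : (n <= m)%N by near: m; exact: nbhs_infty_ge.
  have traj : dual_trajectory F G n m (zt m) u by [].
  apply: (le_trans (riccati_le_dual_cost nm traj)); rewrite lerD//; last first.
    near: m; apply: (cvgr_le _ cvgcost); by rewrite ltrDl.
  apply: (le_trans (ler_norm _)); apply: (le_trans (bilf_norm_le _ _ _)).
  rewrite mulrCA ler_wpM2l//.
  near: m; exact: (cvgr_le _ cvg2).
have [r hr] := choice key.
apply: (@bounded_of_half_step _ n (\sum_i `|r i|)) => //.
have : \forall m \near \oo, forall i, P m i i <= `|P (m - n)%N| / 2 + r i.
  by apply: filter_forall => i; exact: hr.
move=> hall; near=> m.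
have nm : (n <= m)%N by near: m; exact: nbhs_infty_ge.
rewrite nm /=; apply: psd_norm_le_diag; first exact: riccati_psd.
  by rewrite addr_ge0// ?divr_ge0// sumr_ge0.
move=> i; have hm : forall i, P m i i <= `|P (m - n)%N| / 2 + r i by near: m.
apply: (le_trans (hm i)); rewrite lerD2l (le_trans (ler_norm _))//.
by rewrite (bigD1 i)//= lerDl sumr_ge0.
Unshelve. all: by end_near. Qed.

(** * Geometric decay of the estimation error *)

Section ErrorDecay.
Variables (c : nat) (C : 'M[R]_(n, c)) (e : nat -> 'cV[R]_n).
Hypotheses (obs : observable Fbar G) (ctrl : controllable Fbar C).
Hypothesis QbarE : Qbar = C *m C^T.
Hypothesis eE : forall k, e k.+1 = F k *m (1%:M - L k *m G) *m e k.

(* [ell k a] says that [e_k] lies in the ellipsoid [x x^T <= a P_k], a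
   substitute for [e_k^T P_k^-1 e_k <= a] that needs no inverse. *)
Let ell k (a : R) := forall z : 'cV[R]_n,
  ((z^T *m e k) 0 0) ^+ 2 <= a * qf (P k) z.

Let adj (m : nat) (z : 'cV[R]_n) := fix t j := if j is l.+1
  then (F (m - l.+1)%N *m (1%:M - L (m - l.+1)%N *m G))^T *m t l else z.

(** Moving the adjoint one step back is compensated by moving the error one step back, so the error
    at time [m] can be tested at time [m - j]. *)
Let adj_dot m z j : (j <= m)%N -> (adj m z j)^T *m e (m - j)%N = z^T *m e m.
Proof.
elim: j => [|j IH] jm; first by rewrite subn0.
rewrite /= trmx_mul trmxK -mulmxA -eE.
have -> : ((m - j.+1).+1 = m - j)%N by lia.
by rewrite IH// ltnW.
Qed.

(** Testing [e m] against [z] is testing [e (m - N)] against the adjoint state, whose [P]-form is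
    [qf (P m) z] minus the dual cost, by optimality of the adjoint trajectory. *)
Let ell_step N m a (rho : R) : (N <= m)%N -> 0 <= a ->
  (forall z u, dual_trajectory F G N m z u ->
     qf (P m) (z 0%N) - dual_cost Q W N m z u <= rho * qf (P m) (z 0%N)) ->
  ell (m - N)%N a -> ell m (a * rho).
Proof.
move=> Nm a0 hrho he z.
have [traj hq] := riccati_closed_loop (z := adj m z) Nm (fun i _ => erefl).
rewrite -(adj_dot z Nm) (le_trans (he _))// -mulrA ler_wpM2l//.
by apply: le_trans (hrho _ _ traj); rewrite hq addrK.
Qed.

Lemma kalman_error_cvg0 : e @ \oo --> (0 : 'cV[R]_n).
Proof.
have psdW := posdef_psd posW.
have cost0 N m z u : 0 <= dual_cost Q W N m z u.
  by apply: sumr_ge0 => i _; rewrite addr_ge0// psd_ge0.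
have cvgQ' : Q @ \oo --> C *m C^T by rewrite -QbarE.
have [g g0 [M0 _ hM0]] := dual_cost_coercive G cvgF psdQ cvgQ' posW ctrl.
have [b0 hb0] := riccati_bounded obs.
pose M := maxn M0 n.
have hg m z u : (M <= m)%N -> dual_trajectory F G n m z u ->
    g * `|z 0%N| ^+ 2 <= dual_cost Q W n m z u.
  by move=> Mm; apply: hM0 => /=; rewrite (leq_trans _ Mm)// leq_maxl.
have geM m : (M <= m)%N -> (n <= m)%N.
  by apply: leq_trans; exact: leq_maxr.
(* Adding [g] to the upper bound on the forms of [P] ensures [0 < g <= b], hence [0 <= rho < 1]
   below. *)
pose b := (n * n)%:R * b0 + g.
have b00 : 0 <= b0 by exact: le_trans (normr_ge0 _) (hb0 0%N).
have bg : g <= b by rewrite lerDr mulr_ge0.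
have bgt0 : 0 < b by exact: lt_le_trans bg.
have hub m z : qf (P m) z <= b * `|z| ^+ 2.
  rewrite (le_trans (ler_norm _))// (le_trans (bilf_norm_le _ _ _))//.
  rewrite mulrA -expr2 ler_wpM2r ?sqr_ge0//.
  by rewrite (@le_trans _ _ ((n * n)%:R * b0)) ?ler_wpM2l// lerDl ltW.
have hlb m z : (M <= m)%N -> g * `|z| ^+ 2 <= qf (P m) z.
  move=> Mm.
  have [traj ->] := riccati_closed_loop (z := adj m z) (geM _ Mm) (fun i _ => erefl).
  apply: (le_trans (hg _ _ _ Mm traj)).
  by rewrite lerDr psd_ge0//; exact: riccati_psd.
(* The cost over [n] steps is at least [g * |z|^2], hence at least the fraction [g / b] of
   [qf (P m) z]. *)
pose rho := 1 - g / b.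
have rho0 : 0 <= rho by rewrite subr_ge0 ler_pdivrMr// mul1r.
have rho1 : rho < 1 by rewrite ltrBlDr ltrDl divr_gt0.
(* With this [a], [(z^T e_M)^2 <= a * g * |z|^2], and the lower bound [hlb] turns [g * |z|^2] into
   [qf (P M) z]. *)
pose a := (((n * n)%:R * (`|1%:M : 'M[R]_n| * `|e M|)) ^+ 2) / g.
have a0 : 0 <= a by rewrite divr_ge0 ?sqr_ge0// ltW.
have ellM : ell M a.
  move=> z; have := bilf_norm_le (1%:M) z (e M).
  rewrite {1}/bilf mulmx1 => hz.
  rewrite -[leLHS]ger0_norm ?sqr_ge0// normrX.
  have -> : a * qf (P M) z = (a * g) * (qf (P M) z / g) by field; rewrite gt_eqF.
  rewrite divfK ?gt_eqF//.
  apply: (@le_trans _ _ (((n * n)%:R * (`|1%:M : 'M[R]_n| * `|e M|)) ^+ 2 * `|z| ^+ 2)).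
    rewrite -exprMn ler_pXn2r ?nnegrE ?mulr_ge0//.
    by rewrite (le_trans hz)// -!mulrA (mulrC `|e M|).
  by rewrite ler_wpM2l ?sqr_ge0// ler_pdivlMr// mulrC hlb.
have ell_decay j k : (M + j * n <= k)%N -> ell k (a * rho ^+ j).
  elim: j k => [|j IH] k.
    rewrite addn0 mulr1; elim: k => [|k IH].
      by rewrite leqn0 => /eqP M0'; rewrite -M0'.
    rewrite leq_eqVlt => /predU1P[<-//|Mk].
    (* A single step has nonnegative cost, so it preserves the ellipsoid bound with factor 1; this
       covers times that are not [M] plus a multiple of [n]. *)
    rewrite -[a]mulr1; apply: (@ell_step 1) => //; last by rewrite subn1; exact: IH.
    by move=> z u _; rewrite mul1r gerBl.
  rewrite mulSn => Mk; rewrite exprSr mulrA; apply: (@ell_step n).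
  - by lia.
  - by rewrite mulr_ge0// exprn_ge0.
  - move=> z u traj; rewrite /rho mulrBl mul1r lerD2l lerN2.
    rewrite (le_trans _ (hg _ _ _ _ traj))//; last by lia.
    by rewrite mulrAC -mulrA ler_pM2l// ler_pdivrMr// mulrC.
  - by apply: IH; lia.
apply/cvgr0Pnorm_le => eps eps0.
have : a * b * rho ^+ j @[j --> \oo] --> (0 : R).
  rewrite -[0](mulr0 (a * b)); apply: cvgMr; apply: cvg_expr.
  by rewrite ger0_norm.
move=> /cvgr0Pnorm_le /(_ _ (exprn_gt0 2 eps0)) [j _ /(_ j (leqnn j)) /= hj].
exists (M + j * n)%N => // k /= hk.
apply: mx_norm_le; first exact: ltW.
move=> i l; rewrite ord1.
(* Testing against a basis vector reads off one entry of [e k]. *)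
have := ell_decay j k hk (delta_mx i 0).
rewrite trmx_delta -rowE mxE => hi.
rewrite -(@ler_pXn2r _ 2) ?nnegrE ?(ltW eps0)// -normrX ger0_norm ?sqr_ge0//.
rewrite (le_trans hi)// (le_trans _ hj)// (le_trans _ (ler_norm _))//.
rewrite (mulrAC a b); apply: ler_wpM2l.
  by apply: mulr_ge0 => //; exact: exprn_ge0.
rewrite (le_trans (hub _ _))// ler_piMr ?(ltW bgt0)// exprn_ile1//.
apply: mx_norm_le => // i' j'; rewrite mxE.
by case: (_ && _); rewrite ?normr1 ?normr0.
Qed.

End ErrorDecay.

End Riccati.

(** * Application to the inverse filter *)

Lemma cvg_closed_loop (R : realType) (n m p : nat) (F : 'M[R]_n)
    (B : 'M[R]_(n, m)) (H : 'M[R]_(p, n)) (M : nat -> 'M[R]_(m, p))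
    (K : nat -> 'M[R]_(n, p)) (Mbar : 'M[R]_(m, p)) (Kbar : 'M[R]_(n, p)) :
  M @ \oo --> Mbar -> K @ \oo --> Kbar ->
  closed_loop F B H (M k) (K k) @[k --> \oo] --> closed_loop F B H Mbar Kbar.
Proof.
move=> hM hK; apply: cvg_mulmx; last exact: cvg_cst.
apply: cvg_mulmx; apply: cvgB; try exact: cvg_cst.
  by apply: cvg_mulmx => //; exact: cvg_cst.
by do 2 (apply: cvg_mulmx; try exact: cvg_cst).
Qed.

Lemma cvg_input_matrix (R : realType) (n m p : nat)
    (B : 'M[R]_(n, m)) (H : 'M[R]_(p, n)) (M : nat -> 'M[R]_(m, p))
    (K : nat -> 'M[R]_(n, p)) (Mbar : 'M[R]_(m, p)) (Kbar : 'M[R]_(n, p)) :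
  M @ \oo --> Mbar -> K @ \oo --> Kbar ->
  input_matrix B H (M k) (K k) @[k --> \oo] --> input_matrix B H Mbar Kbar.
Proof.
move=> hM hK; apply: cvgD => //; apply: cvgB.
  by apply: cvg_mulmx => //; exact: cvg_cst.
by do 3 (apply: cvg_mulmx => //; try exact: cvg_cst).
Qed.

Theorem theorem1 (R : realType) (n m p na c : nat)
    (F : 'M[R]_n) (B : 'M[R]_(n, m)) (H : 'M[R]_(p, n)) (G : 'M[R]_(na, n))
    (Q : 'M[R]_n) (V : 'M[R]_p) (W : 'M[R]_na)
    (Sigma0 bSigma0 : 'M[R]_n)
    (Mbar : 'M[R]_(m, p)) (Kbar : 'M[R]_(n, p)) (C : 'M[R]_(n, c))
    (* covariances of w_k and v_k, and initial filter covariances *)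
    (hQ : psd Q) (hV : psd V) (hSigma0 : psd Sigma0) (hbSigma0 : psd bSigma0)
    (* existence of the forward filter *)
    (hHB : \rank (H *m B) = m) (hB : \rank B = m)
    (hS : forall k, fwd_innov_cov F B H Q V Sigma0 k \in unitmx)
    (* the forward filter is asymptotically stable, with convergent gains *)
    (hstable : asymptotically_stable (fwd_F F B H Q V Sigma0))
    (hM : fwd_M F B H Q V Sigma0 @ \oo --> Mbar)
    (hK : fwd_K F B H Q V Sigma0 @ \oo --> Kbar)
    (* W is the covariance Sigma_epsilon *)
    (hW : posdef W) :
  let Fbar := closed_loop F B H Mbar Kbar in
  let Ebar := input_matrix B H Mbar Kbar in
  let Qbar := Ebar *m V *m Ebar^T in
  Qbar = C *m C^T ->
  observable Fbar G ->
  controllable Fbar C ->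
  asymptotically_stable
    (inv_error_matrix (fwd_F F B H Q V Sigma0) (fwd_E F B H Q V Sigma0)
       V G W bSigma0).
Proof.

move=> Fbar Ebar Qbar QC obs ctrl e he.
pose Ft := fwd_F F B H Q V Sigma0; pose E := fwd_E F B H Q V Sigma0.
(* [P k] is the covariance predicted for time [k+1]; passing to [P k.+1] uses [Ft k.+1] and
   [E k.+1], so the Riccati coefficients are the forward sequences shifted by one. *)
pose P k := step_inv_pred_cov Ft E V k (inv_cov Ft E V G W bSigma0 k).
have psdN k : psd (E k *m V *m (E k)^T) by exact: psd_congr.
have cvgFt : Ft k.+1 @[k --> \oo] --> Fbar.
  by rewrite (cvg_shiftS Ft); exact: cvg_closed_loop.
have cvgE : E k.+1 @[k --> \oo] --> Ebar.
  by rewrite (cvg_shiftS E); exact: cvg_input_matrix.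
have cvgN : E k.+1 *m V *m (E k.+1)^T @[k --> \oo] --> Qbar.
  apply: cvg_mulmx; last exact: cvg_trmx.
  by apply: cvg_mulmx => //; exact: cvg_cst.
apply: (@kalman_error_cvg0 R n na (fun k => Ft k.+1) G
  (fun k => E k.+1 *m V *m (E k.+1)^T) W P (fun k => psdN k.+1) hW _ _
  Fbar Qbar cvgFt cvgN c C e obs ctrl QC _) => //.
by apply: psdD => //; exact: psd_congr.
Qed.
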